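(* Let $(u_N^n,v_N^n,R^n)$ be a solution of the fully discrete SAV Fourier spectral scheme described in the context (with periodic boundary conditions). Then the scheme is energy dissipative, without any restriction on $\tau$ and $N$, in the sense that $$\mathbf{H}^{n}\le \mathbf{H}^{n-1},\qquad 1\le n\le K+1,$$ where $$\mathbf{H}^n=\tfrac12\|v_N^n\|^2+\tfrac{\kappa}{2}\big\|(-\Delta)^{\alpha/4}u_N^n\big\|^2+(R^n)^2 .$$
   Context: Setting: $\Omega=(a,b)\times(c,d)\subset\mathbb{R}^2$ is a periodic cell with side lengths $2\pi$; all functions are real-valued and $2\pi$-periodic in each variable. $(f,g)=\int_\Omega fg\,d\mathbf{x}$, $\|f\|^2=(f,f)$. Parameters: $\kappa>0$, $1<\alpha\le2$, $\gamma_1,\gamma_2\ge0$. For $u=\sum_{s,l\in\mathbb{Z}}\hat u_{sl}e^{isx_1+ilx_2}$, $(-\Delta)^\beta u=\sum_{s,l}(s^2+l^2)^\beta\hat u_{sl}e^{isx_1+ilx_2}$. $F:\mathbb{R}\to\mathbb{R}$ is nonnegative, $F\in C^3(\mathbb{R})$, $F'$ is locally Lipschitz; $E(w)=\int_\Omega F(w)d\mathbf{x}+C_0$ with the constant $C_0$ chosen such that $E(w)>0$ for all bounded $w$. The scheme approximates $u_{tt}+\kappa(-\Delta)^{\alpha/2}u+\gamma_1(-\Delta)^{\alpha/2}u_t+\gamma_2u_t+F'(u)=0$, with initial data $u^0=u(\cdot,0)$, $v^0=u_t(\cdot,0)$ and $r^0=\sqrt{E(u^0)}$. For a positive integer $N$,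 $X_N$ is the space of real-valued functions in $\mathrm{span}\{e^{isx_1+ilx_2}: s,l\in\mathbb{Z},\,-N/2\le s,l\le N/2-1\}$, and $P_N$ is the $L^2$-orthogonal projection onto $X_N$. $\tau=T/K$ is the time step ($K$ a positive integer), $t_n=n\tau$. For a sequence $w^n$: $\delta_tw^{n+1/2}=(w^{n+1}-w^n)/\tau$, $\bar w^{n+1/2}=(w^{n+1}+w^n)/2$, and for $n\ge1$, $\tilde w^{n+1/2}=(3w^n-w^{n-1})/2$. Scheme: $u_N^0=P_Nu^0$, $v_N^0=P_Nv^0$, $R^0=r^0$; for $n=0,1,\dots,K$ find $(u_N^{n+1},v_N^{n+1})\in X_N\times X_N$ and $R^{n+1}\in\mathbb{R}$ such that for all $(\psi,\varphi)\in X_N\times X_N$ $$(\delta_tu_N^{n+1/2},\psi)=(\bar v_N^{n+1/2},\psi),$$ $$(\delta_tv_N^{n+1/2},\varphi)+\kappa((-\Delta)^{\alpha/2}\bar u_N^{n+1/2},\varphi)+\gamma_1((-\Delta)^{\alpha/2}\bar v_N^{n+1/2},\varphi)+\gamma_2(\bar v_N^{n+1/2},\varphi)+\bar R^{n+1/2}\Big(\tfrac{F'(\tilde u_N^{n+1/2})}{\sqrt{E(\tilde u_N^{n+1/2})}},\varphi\Big)=0,$$ $$\delta_tR^{n+1/2}=\frac{1}{2\sqrt{E(\tilde u_N^{n+1/2})}}\big(F'(\tilde u_N^{n+1/2}),\delta_tu_N^{n+1/2}\big).$$ For $n=0$, $\tilde u_N^{1/2}\in X_N$ (together with $\tilde v_N^{1/2}\in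 X_N$, $\tilde R^{1/2}\in\mathbb{R}$) is defined by the first-step scheme: for all $(\psi,\varphi)\in X_N\times X_N$ $$\Big(\tfrac{\tilde u_N^{1/2}-u_N^0}{\tau/2},\psi\Big)=(\tilde v_N^{1/2},\psi),$$ $$\Big(\tfrac{\tilde v_N^{1/2}-v_N^0}{\tau/2},\varphi\Big)+\kappa((-\Delta)^{\alpha/2}\tilde u_N^{1/2},\varphi)+\gamma_1((-\Delta)^{\alpha/2}\tilde v_N^{1/2},\varphi)+\gamma_2(\tilde v_N^{1/2},\varphi)+\tilde R^{1/2}\Big(\tfrac{F'(u_N^0)}{\sqrt{E(u_N^0)}},\varphi\Big)=0,$$ $$\frac{\tilde R^{1/2}-R^0}{\tau/2}=\frac{1}{2\sqrt{E(u_N^0)}}\Big(F'(u_N^0),\tfrac{\tilde u_N^{1/2}-u_N^0}{\tau/2}\Big).$$ *)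

(* Defs.v *)
From mathcomp Require Export all_boot all_order all_algebra.
From mathcomp Require Export all_classical all_reals all_analysis.
From mathcomp Require Export complex.
Set Implicit Arguments.
Unset Strict Implicit.
Unset Printing Implicit Defensive.
Import Order.TTheory GRing.Theory Num.Theory.
Import numFieldNormedType.Exports.
Local Open Scope classical_set_scope.
Local Open Scope ring_scope.

Definition lebesgue2 (R : realType) := (@lebesgue_measure R \x @lebesgue_measure R)%E.

Definition cell (R : realType) (a b c d : R) : set (R * R) :=
  `]a, b[ `*` `]c, d[.

Definition periodic2pi (R : realType) (f : R * R -> R) : Prop :=
  forall x1 x2 : R,
    f (x1 + 2 * pi, x2) = f (x1, x2) /\ f (x1, x2 + 2 * pi) = f (x1, x2).

Definition inner (R : realType) (D : set (R * R)) (f g : R * R -> R) : R :=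
  \int[@lebesgue2 R]_(x in D) (f x * g x).

Definition normL2 (R : realType) (D : set (R * R)) (f : R * R -> R) : R :=
  Num.sqrt (inner D f f).

Definition square_integrable (R : realType) (D : set (R * R))
    (f : R * R -> R) : Prop :=
  measurable_fun (D : set (measurableTypeR R * measurableTypeR R)) f /\
  (@lebesgue2 R).-integrable D (fun x => (f x ^+ 2)%:E).

(* exp (i s x1 + i l x2) *)
Definition fmode (R : realType) (s l : int) (x : R * R) : R[i] :=
  let t := s%:~R * x.1 + l%:~R * x.2 in Complex (cos t) (sin t).

(* (2 pi)^-2 times the integral over D of u exp (- i s x1 - i l x2); the
   integral of a complex function is taken on real and imaginary parts. *)
Definition fcoef (R : realType) (D : set (R * R)) (u : R * R -> R)
    (s l : int) : R[i] :=
  (((2 * pi) ^- 2 : R)%:C)%C *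
  Complex (inner D u (fun x => complex.Re (fmode (- s) (- l) x)))
          (inner D u (fun x => complex.Im (fmode (- s) (- l) x))).

(* the integers -M, ..., M *)
Definition zrange (M : nat) : seq int :=
  [seq i%:Z - M%:Z | i <- iota 0 (2 * M).+1].

(* The Fourier multiplier (s^2 + l^2)^beta, as the limit of the square partial
   sums of the series. These sums are real because u is real-valued and
   the square is symmetric, so that Re drops nothing. *)
Definition fracLap (R : realType) (D : set (R * R)) (beta : R)
    (u : R * R -> R) (x : R * R) : R :=
  lim ((fun M : nat => complex.Re
    (\sum_(s <- zrange M) \sum_(l <- zrange M)
       ((((s%:~R ^+ 2 + l%:~R ^+ 2 : R) `^ beta))%:C)%C
         * fcoef D u s l * fmode s l x)) @ \oo).

(* The integers s with - N / 2 <= s <= N / 2 - 1, N being possibly odd. *)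
Definition XN_freqs (N : nat) : seq int :=
  [seq s <- zrange N | - N%:Z <= 2 * s <= N%:Z - 2].

(* Real-valued functions in the complex span of the modes. *)
Definition XN (R : realType) (N : nat) : set (R * R -> R) :=
  [set u | exists c : int -> int -> R[i], forall x : R * R,
     ((u x)%:C)%C
       = \sum_(s <- XN_freqs N) \sum_(l <- XN_freqs N) c s l * fmode s l x].

Definition is_projXN (R : realType) (D : set (R * R)) (N : nat)
    (w p : R * R -> R) : Prop :=
  XN N p /\ forall phi, XN N phi -> inner D (w - p) phi = 0.

Definition C3 (R : realType) (F : R -> R) : Prop :=
  (forall (k : nat) (x : R), (k < 3)%N -> derivable (derive1n k F) x 1) /\
  continuous (derive1n 3 F).

Definition locally_lipschitz (R : realType) (f : R -> R) : Prop :=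
  forall x : R, exists2 e : R, 0 < e & [lipschitz f y | y in ball x e].

Definition Efun (R : realType) (D : set (R * R)) (F : R -> R) (C0 : R)
    (w : R * R -> R) : R :=
  \int[@lebesgue2 R]_(x in D) F (w x) + C0.

Definition Efun_pos (R : realType) (D : set (R * R)) (F : R -> R) (C0 : R)
  : Prop :=
  forall w : R * R -> R, periodic2pi w ->
    measurable_fun [set: measurableTypeR R * measurableTypeR R] w ->
    (exists M : R, forall x, `|w x| <= M) -> 0 < Efun D F C0 w.

(* The three relations shared by the first-step scheme and the main scheme:
   du, dv, dr are the difference quotients, ub, vb, rb the values at the half
   step, and w is the function at which F' and E are evaluated. *)
Definition sav_relations (R : realType) (D : set (R * R)) (N : nat)
    (kappa alpha gamma1 gamma2 : R) (F : R -> R) (C0 : R)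
    (du dv : R * R -> R) (dr : R) (ub vb : R * R -> R) (rb : R)
    (w : R * R -> R) : Prop :=
  [/\ forall psi, XN N psi -> inner D du psi = inner D vb psi,
      forall phi, XN N phi ->
        inner D dv phi
        + kappa * inner D (fracLap D (alpha / 2) ub) phi
        + gamma1 * inner D (fracLap D (alpha / 2) vb) phi
        + gamma2 * inner D vb phi
        + rb * inner D
            (fun x => derive1 F (w x) / Num.sqrt (Efun D F C0 w)) phi = 0
    & dr = (2 * Num.sqrt (Efun D F C0 w))^-1
           * inner D (fun x => derive1 F (w x)) du].

Definition utilde (R : realType) (ut : R * R -> R) (u : nat -> R * R -> R)
    (n : nat) : R * R -> R :=
  if n is m.+1 then 2^-1 *: (3 *: u m.+1 - u m) else ut.

Record sav_solution (R : realType) (D : set (R * R)) (N K : nat)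
    (kappa alpha gamma1 gamma2 : R) (F : R -> R) (C0 tau : R)
    (u0 v0 : R * R -> R)
    (u v : nat -> R * R -> R) (r : nat -> R)
    (ut vt : R * R -> R) (rt : R) : Prop := SavSolution {
  sav_u0 : is_projXN D N u0 (u 0%N);
  sav_v0 : is_projXN D N v0 (v 0%N);
  sav_r0 : r 0%N = Num.sqrt (Efun D F C0 u0);
  sav_XN_ut : XN N ut;
  sav_XN_vt : XN N vt;
  sav_first : sav_relations D N kappa alpha gamma1 gamma2 F C0
    ((tau / 2)^-1 *: (ut - u 0%N)) ((tau / 2)^-1 *: (vt - v 0%N))
    ((rt - r 0%N) / (tau / 2))
    ut vt rt (u 0%N);
  sav_XN_u : forall n, (n <= K)%N -> XN N (u n.+1);
  sav_XN_v : forall n, (n <= K)%N -> XN N (v n.+1);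
  sav_step : forall n, (n <= K)%N ->
    sav_relations D N kappa alpha gamma1 gamma2 F C0
      (tau^-1 *: (u n.+1 - u n)) (tau^-1 *: (v n.+1 - v n))
      ((r n.+1 - r n) / tau)
      (2^-1 *: (u n.+1 + u n)) (2^-1 *: (v n.+1 + v n))
      ((r n.+1 + r n) / 2)
      (utilde ut u n)
}.

Definition energyH (R : realType) (D : set (R * R)) (kappa alpha : R)
    (u v : nat -> R * R -> R) (r : nat -> R) (n : nat) : R :=
  2^-1 * normL2 D (v n) ^+ 2
  + kappa / 2 * normL2 D (fracLap D (alpha / 4) (u n)) ^+ 2
  + r n ^+ 2.

(* Main.v *)
Require Import Defs.
From mathcomp Require Import ring zify measurable_realfun.
Import Order.TTheory GRing.Theory Num.Theory.
Import numFieldNormedType.Exports.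
Local Open Scope classical_set_scope.
Local Open Scope ring_scope.

(** Write [du], [dv] for the difference quotients and [ub], [vb] for the
    midpoint values of a step. The scheme is conservative up to damping because
    [vb] may serve both as a test function and as the velocity: the first
    relation says that [du - vb], itself an element of the discrete space, is
    orthogonal to that space, so [du = vb] everywhere ([XN_eq_of_inner]). Testing
    the second relation with [vb] then gives, term by term,
    - [(dv, vb)], the increment of the kinetic energy divided by tau;
    - [(Lap ub, vb) = (Lap ub, du)], the increment of the elastic energy divided
      by tau (up to kappa), because the fractional Laplacian is symmetric on the
      discrete space and [|| Lap^(1/2) f ||^2 = (Lap f, f)];
    - two damping terms, which are nonnegative;
    - the nonlinear term, which by the third relation is [2 rb dr], that is, the
      increment of the square of the auxiliary variable divided by tau.
    The energy increment is therefore minus tau times the damping. This holds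
    wherever the nonlinearity is evaluated, so the first step and the
    extrapolated ones are treated alike.

    The analytic content is that the fractional Laplacian, defined as the limit
    of square Fourier partial sums, has the expected algebra on trigonometric
    polynomials. Each partial sum is an operator [fourier_mult] built from the
    real cosine and sine coefficients. Orthogonality of the harmonics
    ([Rintegral_cell_cos], by Fubini and the fundamental theorem of calculus)
    shows that it acts diagonally on a polynomial as soon as the square of
    frequencies contains that of the polynomial ([fourier_mult_trig]), so the
    partial sums are eventually constant. Symmetry and positivity are read off
    from the expression [inner_fourier_mult] of its quadratic form as a weighted
    sum over the coefficients. *)

Set Implicit Arguments.
Unset Strict Implicit.

(** * Integration of bounded measurable functions over the cell *)

(** A class on which the inner product is bilinear: it is stable under products,
    and its members are integrable over the cell, which has finite measure. *)
Definition bmeas (R : realType) (f : R * R -> R) : Prop :=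
  measurable_fun [set: measurableTypeR R * measurableTypeR R] f /\
  exists M : R, forall x, `|f x| <= M.

Section BoundedMeasurable.
Variable R : realType.
Implicit Types f g : R * R -> R.

Lemma bmeas_cst (k : R) : bmeas (fun=> k).
Proof. by split; [exact: measurable_cst | exists `|k|]. Qed.

Lemma bmeasD f g : bmeas f -> bmeas g -> bmeas (fun x => f x + g x).
Proof.
move=> [mf [M hM]] [mg [M' hM']]; split; first exact: measurable_funD.
by exists (M + M') => x; rewrite (le_trans (ler_normD _ _)) ?lerD.
Qed.

Lemma bmeasM f g : bmeas f -> bmeas g -> bmeas (fun x => f x * g x).
Proof.
move=> [mf [M hM]] [mg [M' hM']]; split; first exact: measurable_funM.
by exists (M * M') => x; rewrite normrM ler_pM.
Qed.

Lemma bmeasZ k f : bmeas f -> bmeas (fun x => k * f x).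
Proof. by move=> hf; apply: bmeasM => //; exact: bmeas_cst. Qed.

Lemma bmeas_sum (I : Type) (s : seq I) (h : I -> R * R -> R) :
  (forall i, bmeas (h i)) -> bmeas (fun x => \sum_(i <- s) h i x).
Proof.
move=> hh; elim: s => [|i s IH].
  under eq_fun do rewrite big_nil.
  exact: bmeas_cst.
under eq_fun do rewrite big_cons.
exact: bmeasD.
Qed.

Lemma bmeas_comp (G : R -> R) f : continuous G -> bmeas f -> bmeas (G \o f).
Proof.
move=> cG [mf [M hM]]; split.
  by apply: measurableT_comp => //; exact: continuous_measurable_fun.
have M0 : 0 <= M by exact: le_trans (hM (0, 0)).
have cN : {within `[- M, M], continuous (fun y => `|G y|)}.
  apply: continuous_subspaceT => y; apply: continuous_comp; first exact: cG.
  exact: norm_continuous.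
(* The values of [f] stay in a segment, on which [G] is bounded. *)
have [y _ hy] := EVT_max ((ge0_cp M0).2) cN.
exists (`|G y|) => x; apply: hy.
by rewrite in_itv /= -ler_norml.
Qed.

End BoundedMeasurable.

Section Cell.
Variable R : realType.
Variables (a c : R).
Let D := cell a (a + 2 * pi) c (c + 2 * pi).

Lemma measurable_cell : measurable (D : set (measurableTypeR R * measurableTypeR R)).
Proof. by apply: measurableX; exact: measurable_itv. Qed.

Lemma lebesgue_period (z : R) :
  lebesgue_measure (`]z, z + 2 * pi[%classic : set R) = (2 * pi)%:E.
Proof.
rewrite lebesgue_measure_itv /= lte_fin ltrDl mulr_gt0 ?pi_gt0//.
by rewrite -EFinB; congr EFin; ring.
Qed.

Lemma lebesgue2_cell : @lebesgue2 R D = ((2 * pi) ^+ 2)%:E.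
Proof.
rewrite /lebesgue2 product_measure1E /=; [|exact: measurable_itv..].
by rewrite !lebesgue_period.
Qed.

Lemma bmeas_integrable f : bmeas f -> (@lebesgue2 R).-integrable D (EFin \o f).
Proof.
move=> [mf [M hM]]; apply: measurable_bounded_integrable.
- exact: measurable_cell.
- suff : (@lebesgue2 R D < +oo)%E by [].
  by rewrite lebesgue2_cell ltry.
- exact: measurable_funTS.
- by exists M; split; [exact: num_real | move=> y My x _; exact: le_trans (ltW My)].
Qed.

Lemma innerC f g : inner D f g = inner D g f.
Proof. by apply: eq_Rintegral => x _; rewrite mulrC. Qed.

Lemma innerDl f g h : bmeas f -> bmeas g -> bmeas h ->
  inner D (fun x => f x + g x) h = inner D f h + inner D g h.
Proof.
move=> hf hg hh; rewrite /inner.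
under eq_Rintegral do rewrite mulrDl.
apply: RintegralD; first exact: measurable_cell.
all: by apply: bmeas_integrable; exact: bmeasM.
Qed.

Lemma innerZl k f h : bmeas f -> bmeas h ->
  inner D (fun x => k * f x) h = k * inner D f h.
Proof.
move=> hf hh; rewrite /inner.
under eq_Rintegral do rewrite -mulrA.
apply: RintegralZl; first exact: measurable_cell.
by apply: bmeas_integrable; exact: bmeasM.
Qed.

Lemma inner_suml (I : Type) (s : seq I) (F : I -> R * R -> R) h :
  (forall i, bmeas (F i)) -> bmeas h ->
  inner D (fun x => \sum_(i <- s) F i x) h = \sum_(i <- s) inner D (F i) h.
Proof.
move=> hF hh; elim: s => [|i s IH].
  rewrite big_nil /inner; under eq_Rintegral do rewrite big_nil mul0r.
  by rewrite Rintegral_cst ?mul0r//; exact: measurable_cell.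
under [X in inner _ X _]eq_fun do rewrite big_cons.
by rewrite innerDl// ?IH ?big_cons//; exact: bmeas_sum.
Qed.

Lemma inner_ge0 f : 0 <= inner D f f.
Proof. by apply: Rintegral_ge0 => x _; rewrite -expr2 sqr_ge0. Qed.

Lemma normL2_sqr f : normL2 D f ^+ 2 = inner D f f.
Proof. by rewrite sqr_sqrtr// inner_ge0. Qed.

Lemma cosD2piz (t : R) (l : int) : cos (t + l%:~R * (2 * pi)) = cos t.
Proof.
have cosn (n : nat) (y : R) : cos (y + n%:R * (2 * pi)) = cos y.
  rewrite -[RHS](periodicn (@cosD2pi R) n); congr (cos (y + _)).
  by rewrite -[RHS]mulr_natl -[pi *+ 2]mulr_natl.
case: l => n; first by rewrite -pmulrn cosn.
by rewrite -(cosn n.+1) NegzE mulrNz -pmulrn -addrA mulNr addNr addr0.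
Qed.

Lemma sinD2piz (t : R) (l : int) : sin (t + l%:~R * (2 * pi)) = sin t.
Proof. by rewrite -!cosBpihalf addrAC cosD2piz. Qed.

(** The antiderivative takes equal values at the ends of a period. The phase [t]
    absorbs the other variable in an iterated integral, and the sine is the phase
    [- (pi / 2)]. *)
Lemma integral_cos_period (t z : R) (l : int) : l != 0 ->
  (\int[@lebesgue_measure R]_(y in `]z, (z + 2 * pi)%R[)
     (cos (t + l%:~R * y))%:E = 0)%E.
Proof.
move=> l0.
have lR : (l%:~R : R) != 0 by rewrite intr_eq0.
have zz : z < z + 2 * pi by rewrite ltrDl mulr_gt0 ?pi_gt0.
have cc : continuous (fun y : R => cos (t + l%:~R * y)).
  move=> y; apply: continuous_comp; last exact: continuous_cos.
  apply: continuousD; first exact: cst_continuous.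
  by apply: continuousM; [exact: cst_continuous | exact: cvg_id].
have mc : measurable_fun [set: measurableTypeR R] (fun y : R => cos (t + l%:~R * y)).
  exact: continuous_measurable_fun.
have dF (y : R) : is_derive y 1 (fun y : R => l%:~R^-1 * sin (t + l%:~R * y))
    (cos (t + l%:~R * y)).
  apply: is_derive_eq.
  by rewrite !(scaler0, add0r, addr0, mul0r, scale0r) /GRing.scale /= mulr1; field.
rewrite integral_itv_bndo_bndc; last exact/measurable_EFinP/measurable_funTS.
rewrite integral_itv_obnd_cbnd; last exact/measurable_EFinP/measurable_funTS.
rewrite (@continuous_FTC2 _ _ (fun y => l%:~R^-1 * sin (t + l%:~R * y)))//.
- by rewrite mulrDr addrA sinD2piz subee.
- exact: continuous_subspaceT.
- have cF (y : R) :
    {for y, continuous (fun y : R => l%:~R^-1 * sin (t + l%:~R * y))}.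
    by apply/differentiable_continuous/derivable1_diffP; exact: ex_derive.
  split; first by move=> y _; exact: ex_derive.
    exact/cvg_at_right_filter/cF.
  exact/cvg_at_left_filter/cF.
- by move=> y _; rewrite derive1E; exact: derive_val.
Qed.
End Cell.

(** * Orthogonality of the harmonics *)

Definition phase (R : realType) (k : int * int) (x : R * R) : R :=
  k.1%:~R * x.1 + k.2%:~R * x.2.

Section Orthogonality.
Variable R : realType.
Variables (a c : R).
Let D := cell a (a + 2 * pi) c (c + 2 * pi).
Local Notation phase := (@phase R).

Lemma bmeas_cos (t : R) k : bmeas (fun x => cos (t + phase k x)).
Proof.
split; last by exists 1 => x; rewrite ler_norml cos_geN1 cos_le1.
apply: (@measurableT_comp _ _ _ _ _ _ (@cos R)).
  by apply: continuous_measurable_fun; exact: continuous_cos.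
apply: measurable_funD; first exact: measurable_cst.
apply: measurable_funD; apply: measurable_funM; try exact: measurable_cst.
  exact: measurable_fst.
exact: measurable_snd.
Qed.

(** If one of the two frequencies is nonzero, integrating first in the
    corresponding variable already gives zero. *)
Lemma Rintegral_cell_cos (t : R) k :
  \int[@lebesgue2 R]_(x in D) cos (t + phase k x) =
  if k == (0, 0) then (2 * pi) ^+ 2 * cos t else 0.
Proof.
case: k => s l; case: eqP => [[-> ->]|/eqP k0].
  under eq_Rintegral do rewrite /phase /= !mul0r !addr0.
  transitivity (cos t * fine (@lebesgue2 R D)).
    exact: (Rintegral_cst _ (measurable_cell a c)).
  by rewrite lebesgue2_cell mulrC.
rewrite /Rintegral integral_mkcond.
have ig : (@lebesgue2 R).-integrable setT
   ((fun x => (cos (t + phase (s, l) x))%:E) \_ D).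
  apply/(integrable_mkcond _ (measurable_cell a c)).
  exact/bmeas_integrable/bmeas_cos.
have [l0|l0] := eqVneq l 0.
  have s0 : s != 0 by apply: contraNneq k0 => ->; rewrite l0.
  rewrite /lebesgue2 -(integral21_prod_meas1 ig) /fubini_G /=.
  under eq_integral => y _.
    rewrite (_ : (\int[_]_x _)%E = 0%E); first over.
    have [yD|yD] := boolP (y \in (`]c, (c + 2 * pi)%R[%classic : set R)).
      rewrite -[RHS](integral_cos_period (t + l%:~R * y) a s0) [RHS]integral_mkcond.
      apply: eq_integral => x _; rewrite !patchE in_setX /= yD andbT.
      by case: ifP => // _; rewrite /phase /=; congr (cos _)%:E; ring.
    rewrite (eq_integral (cst 0%E)) ?integral0// => x _.
    by rewrite patchE in_setX /= (negbTE yD) andbF.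
  by rewrite integral0.
rewrite /lebesgue2 -(integral12_prod_meas1 ig) /fubini_F /=.
under eq_integral => x _.
  rewrite (_ : (\int[_]_y _)%E = 0%E); first over.
  have [xD|xD] := boolP (x \in (`]a, (a + 2 * pi)%R[%classic : set R)).
    rewrite -[RHS](integral_cos_period (t + s%:~R * x) c l0) [RHS]integral_mkcond.
    apply: eq_integral => y _; rewrite !patchE in_setX /= xD andTb.
    by case: ifP => // _; rewrite /phase /= addrA.
  rewrite (eq_integral (cst 0%E)) ?integral0// => y _.
  by rewrite patchE in_setX /= (negbTE xD).
by rewrite integral0.
Qed.
End Orthogonality.

(** * Squares of frequencies *)

Definition box (M : nat) : seq (int * int) :=
  [seq (s, l) | s <- zrange M, l <- zrange M].

Lemma mem_zrange M (s : int) : (s \in zrange M) = (`|s| <= M)%N.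
Proof.
apply/mapP/idP => [[n nM ->]|sM].
  by move: nM; rewrite mem_iota; lia.
exists (absz (s + M%:Z)); last by lia.
by rewrite mem_iota; lia.
Qed.

Lemma zrange_uniq M : uniq (zrange M).
Proof. by rewrite map_inj_uniq ?iota_uniq// => i j; lia. Qed.

Lemma mem_box M k : (k \in box M) = (`|k.1| <= M)%N && (`|k.2| <= M)%N.
Proof.
case: k => s l; rewrite -!mem_zrange; apply/allpairsP/andP => /=.
  by case=> -[p q] /= [? ? [-> ->]].
by case=> ? ?; exists (s, l).
Qed.

Lemma box_uniq M : uniq (box M).
Proof. by apply: allpairs_uniq; rewrite ?zrange_uniq// => -[? ?] [? ?]. Qed.

Lemma boxN M k : (- k \in box M) = (k \in box M).
Proof. by rewrite !mem_box /= !abszN. Qed.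

Lemma box_sub M N : (N <= M)%N -> {subset box N <= box M}.
Proof.
by move=> NM k; rewrite !mem_box => /andP[k1 k2]; rewrite !(leq_trans _ NM).
Qed.

Lemma big_box (V : nmodType) M (G : int * int -> V) :
  \sum_(s <- zrange M) \sum_(l <- zrange M) G (s, l) = \sum_(k <- box M) G k.
Proof. by rewrite big_allpairs_dep. Qed.

Lemma big_box_pred1 (V : nmodType) M (G : int * int -> V) j : j \in box M ->
  \sum_(k <- box M) (if k == j then G k else 0) = G j.
Proof.
move=> jM; rewrite -big_mkcond /= -big_filter.
by rewrite filter_pred1_uniq ?box_uniq// big_seq1.
Qed.

(** * Fourier multipliers on trigonometric polynomials *)

Section Multipliers.
Variable R : realType.
Variables (a c : R).
Let D := cell a (a + 2 * pi) c (c + 2 * pi).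
Implicit Types (f g : R * R -> R) (j k : int * int) (m : int * int -> R).

Definition hcos k (x : R * R) : R := cos (phase k x).
Definition hsin k (x : R * R) : R := sin (phase k x).

Lemma phaseD j k (x : R * R) : phase (j + k) x = phase j x + phase k x.
Proof. by rewrite /phase /= !intrD; ring. Qed.

Lemma phaseN k (x : R * R) : phase (- k) x = - phase k x.
Proof. by rewrite /phase /= !intrN; ring. Qed.

Lemma bmeas_hcos k : bmeas (hcos k).
Proof.
have := bmeas_cos (0 : R) k.
by under eq_fun do rewrite add0r.
Qed.

Lemma hsinE k : hsin k = fun x => cos (- (pi / 2) + phase k x).
Proof. by apply/funext => x; rewrite addrC cosBpihalf. Qed.

Lemma hcosE k : hcos k = fun x => cos (0 + phase k x).
Proof. by apply/funext => x; rewrite add0r. Qed.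

Lemma bmeas_hsin k : bmeas (hsin k).
Proof. by rewrite hsinE; exact: bmeas_cos. Qed.

Lemma inner_cos_cos (t t' : R) j k :
  inner D (fun x => cos (t + phase j x)) (fun x => cos (t' + phase k x)) =
  (2 * pi) ^+ 2 / 2 * ((if k == j then cos (t - t') else 0) +
                       (if k == - j then cos (t + t') else 0)).
Proof.
transitivity (2^-1 * (\int[@lebesgue2 R]_(x in D) cos (t - t' + phase (j - k) x)
   + \int[@lebesgue2 R]_(x in D) cos (t + t' + phase (j + k) x))).
  rewrite -RintegralD; [|exact: measurable_cell|exact/bmeas_integrable/bmeas_cos..].
  rewrite -RintegralZl; [|exact: measurable_cell|]; last first.
    by apply: bmeas_integrable; apply: bmeasD; exact: bmeas_cos.
  apply: eq_Rintegral => x _; rewrite !phaseD phaseN.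
  rewrite (_ : t - t' + _ = (t + phase j x) - (t' + phase k x)); last by ring.
  rewrite (_ : t + t' + _ = (t + phase j x) + (t' + phase k x)); last by ring.
  move: (t + phase j x) (t' + phase k x) => p q.
  by rewrite cosB cosD; field.
rewrite !Rintegral_cell_cos -![_ == (0, 0)]/(_ == 0) subr_eq0 [j == k]eq_sym.
rewrite [j + k]addrC addr_eq0.
by do 2 case: ifP => _; field.
Qed.

Lemma inner_cos_hcos (t : R) j k :
  inner D (fun x => cos (t + phase j x)) (hcos k) =
  (2 * pi) ^+ 2 / 2 * ((if k == j then cos t else 0) +
                       (if k == - j then cos t else 0)).
Proof. by rewrite hcosE inner_cos_cos subr0 addr0. Qed.

Lemma inner_cos_hsin (t : R) j k :
  inner D (fun x => cos (t + phase j x)) (hsin k) =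
  (2 * pi) ^+ 2 / 2 * ((if k == j then - sin t else 0) +
                       (if k == - j then sin t else 0)).
Proof. by rewrite hsinE inner_cos_cos opprK cosDpihalf cosBpihalf. Qed.

(** The square partial sum of the Fourier series with symbol [m], in real form. It
    is defined for every function, and its range lies in the trigonometric
    polynomials of degree at most [M]. *)
Definition fourier_mult M m f (x : R * R) : R :=
  (2 * pi) ^- 2 * \sum_(k <- box M)
    m k * (inner D f (hcos k) * hcos k x + inner D f (hsin k) * hsin k x).

Lemma bmeas_fourier_mult M m f : bmeas (fourier_mult M m f).
Proof.
apply/bmeasZ/bmeas_sum => k; apply/bmeasZ/bmeasD; apply: bmeasZ.
  exact: bmeas_hcos.
exact: bmeas_hsin.
Qed.

Lemma fourier_mult_lin M m f g (p q : R) : bmeas f -> bmeas g ->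
  fourier_mult M m (fun x => p * f x + q * g x) =
  fun x => p * fourier_mult M m f x + q * fourier_mult M m g x.
Proof.
move=> hf hg; apply/funext => x; rewrite /fourier_mult !mulr_sumr -big_split /=.
have hpf := bmeasZ p hf; have hqg := bmeasZ q hg.
apply: eq_bigr => k _.
have hc := bmeas_hcos k; have hs := bmeas_hsin k.
by rewrite !innerDl// !innerZl//; ring.
Qed.

Lemma fourier_mult_sum M m (I : Type) (s : seq I) (F : I -> R * R -> R) :
  (forall i, bmeas (F i)) ->
  fourier_mult M m (fun x => \sum_(i <- s) F i x) =
  fun x => \sum_(i <- s) fourier_mult M m (F i) x.
Proof.
move=> hF; apply/funext => x; rewrite /fourier_mult -mulr_sumr exchange_big /=.
congr (_ * _); apply: eq_bigr => k _; rewrite -mulr_sumr; congr (_ * _).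
rewrite big_split /= !inner_suml ?mulr_suml//.
  exact: bmeas_hsin.
exact: bmeas_hcos.
Qed.

(** Only the frequencies [j] and [- j] see the wave; each contributes half of it,
    which is why the symbol must be even. At [j = 0] the two coincide and the
    single frequency is counted twice. *)
Lemma fourier_mult_cos M m (t : R) j : (forall k, m (- k) = m k) -> j \in box M ->
  fourier_mult M m (fun x => cos (t + phase j x)) =
  fun x => m j * cos (t + phase j x).
Proof.
move=> meven jM; apply/funext => x; rewrite /fourier_mult.
have NjM : - j \in box M by rewrite boxN.
(* [e] is the sign with which the sine coefficient enters: the sine is odd, so it
   differs between [j] and [- j]. *)
pose G (e : R) k := 2^-1 * m k * (cos t * hcos k x + e * sin t * hsin k x).
transitivity (\sum_(k <- box M) (if k == j then G (-1) k else 0) +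
              \sum_(k <- box M) (if k == - j then G 1 k else 0)).
  have pi0 : (pi : R) != 0 by rewrite gt_eqF ?pi_gt0.
  rewrite mulr_sumr -big_split /=; apply: eq_bigr => k _.
  rewrite inner_cos_hcos inner_cos_hsin /G.
  move: (pi : R) pi0 => P P0.
  by do 2 case: ifP => _; field.
rewrite !big_box_pred1// /G meven /hcos /hsin phaseN cosN sinN cosD.
by field.
Qed.

(** The degree bound [N] is that of the symmetric square: the discrete space, whose
    frequencies are not symmetric, embeds in it because its members are real. *)
Definition trig N (p q : int * int -> R) (x : R * R) : R :=
  \sum_(k <- box N) (p k * hcos k x + q k * hsin k x).

Lemma bmeas_trig N p q : bmeas (trig N p q).
Proof.
apply: bmeas_sum => k; apply: bmeasD; apply: bmeasZ.
  exact: bmeas_hcos.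
exact: bmeas_hsin.
Qed.

(** The right-hand side does not depend on [M]: this is what makes the partial
    sums of the fractional Laplacian stationary. *)
Lemma fourier_mult_trig M N m p q : (N <= M)%N -> (forall k, m (- k) = m k) ->
  fourier_mult M m (trig N p q) = trig N (m \* p) (m \* q).
Proof.
move=> NM meven; rewrite /trig fourier_mult_sum; last first.
  move=> k; apply: bmeasD; apply: bmeasZ; first exact: bmeas_hcos.
  exact: bmeas_hsin.
apply/funext => x; apply: eq_big_seq => k kN.
have kM := box_sub NM kN.
rewrite fourier_mult_lin; [|exact: bmeas_hcos|exact: bmeas_hsin].
rewrite hcosE hsinE !fourier_mult_cos// /=; ring.
Qed.

(** Symmetry and positivity of the multiplier are visible on this form, for all
    bounded measurable functions. *)
Lemma inner_fourier_mult M m f g : bmeas g ->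
  inner D (fourier_mult M m f) g = (2 * pi) ^- 2 * \sum_(k <- box M)
    m k * (inner D f (hcos k) * inner D g (hcos k) +
           inner D f (hsin k) * inner D g (hsin k)).
Proof.
move=> hg.
have hh k : bmeas (fun x => inner D f (hcos k) * hcos k x
                          + inner D f (hsin k) * hsin k x).
  by apply: bmeasD; apply: bmeasZ; [exact: bmeas_hcos | exact: bmeas_hsin].
rewrite innerZl//; last by apply: bmeas_sum => k; exact: bmeasZ.
rewrite inner_suml//; last by move=> k; exact: bmeasZ.
congr (_ * _); apply: eq_bigr => k _.
rewrite innerZl// innerDl//.
all: try by apply: bmeasZ; first [exact: bmeas_hcos | exact: bmeas_hsin].
rewrite !innerZl//; [|exact: bmeas_hsin|exact: bmeas_hcos].
by rewrite ![inner _ g _]innerC.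
Qed.

Lemma inner_fourier_multC M m f g : bmeas f -> bmeas g ->
  inner D (fourier_mult M m f) g = inner D (fourier_mult M m g) f.
Proof.
move=> hf hg; rewrite !inner_fourier_mult//; congr (_ * _).
by apply: eq_bigr => k _; rewrite ![inner _ f _ * _]mulrC.
Qed.

Lemma inner_fourier_mult_ge0 M m f : (forall k, 0 <= m k) -> bmeas f ->
  0 <= inner D (fourier_mult M m f) f.
Proof.
move=> m0 hf; rewrite inner_fourier_mult// mulr_ge0 ?invr_ge0 ?sqr_ge0//.
apply: sumr_ge0 => k _.
by rewrite mulr_ge0// -!expr2 addr_ge0 ?sqr_ge0.
Qed.

(** Parseval: the squared norm is a positive multiple of the sum of the squared
    coefficients, since the multiplier with symbol 1 is the identity. It yields
    equality at every point, not only almost everywhere. *)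
Lemma trig_inner_eq0 N p q : inner D (trig N p q) (trig N p q) = 0 ->
  trig N p q = fun=> 0.
Proof.
set f := trig N p q; have hf : bmeas f by exact: bmeas_trig.
have f1 : fourier_mult N (fun=> 1) f = f.
  rewrite fourier_mult_trig//; apply/funext => x.
  by apply: eq_bigr => k _; rewrite /= !mul1r.
rewrite -{1}f1 inner_fourier_mult// => /eqP; rewrite mulf_eq0 invr_eq0 sqrf_eq0.
rewrite mulf_eq0 pnatr_eq0 /= gt_eqF ?pi_gt0//= psumr_eq0; last first.
  by move=> k _; rewrite mul1r -!expr2 addr_ge0 ?sqr_ge0.
move=> /allP coef0; rewrite -f1; apply/funext => x; rewrite /fourier_mult.
rewrite big1_seq ?mulr0// => k /andP[_ /coef0] /=.
rewrite mul1r -!expr2 paddr_eq0 ?sqr_ge0// !sqrf_eq0 => /andP[/eqP -> /eqP ->].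
by rewrite !mul0r addr0 mulr0.
Qed.

End Multipliers.

(** * The discrete space and the fractional Laplacian *)

Lemma Re_sum (R : realType) (I : Type) (s : seq I) (G : I -> R[i]) :
  complex.Re (\sum_(i <- s) G i) = \sum_(i <- s) complex.Re (G i).
Proof. by apply: (big_morph (@complex.Re R)) => // -[? ?] [? ?]. Qed.

Lemma XN_lin (R : realType) N (f g : R * R -> R) (p q : R) :
  XN N f -> XN N g -> XN N (fun x => p * f x + q * g x).
Proof.
move=> [cf hf] [cg hg].
exists (fun s l => (p%:C)%C * cf s l + (q%:C)%C * cg s l) => x.
rewrite rmorphD !rmorphM /= hf hg !mulr_sumr -big_split /=.
apply: eq_bigr => s _; rewrite !mulr_sumr -big_split /=.
by apply: eq_bigr => l _; rewrite mulrDl !mulrA.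
Qed.

(** Taking the real part of the complex expansion suffices; the coefficients are
    extended by zero to the symmetric square. *)
Lemma XN_trig (R : realType) N (f : R * R -> R) :
  XN N f -> exists p q, f = trig N p q.
Proof.
move=> [cf hf].
pose w (k : int * int) : R[i] :=
  if (k.1 \in XN_freqs N) && (k.2 \in XN_freqs N) then cf k.1 k.2 else 0.
exists (fun k => complex.Re (w k)), (fun k => - complex.Im (w k)).
apply/funext => x; rewrite -[LHS]/(complex.Re (f x)%:C%C) hf.
transitivity (complex.Re (\sum_(k <- box N) w k * fmode k.1 k.2 x)).
  congr complex.Re; rewrite -big_box [LHS]big_filter big_mkcond /=.
  apply: eq_big_seq => s sN; case: ifP => hs; last first.
    by rewrite big1// => l _; rewrite /w mem_filter hs mul0r.
  rewrite big_filter big_mkcond /=; apply: eq_big_seq => l lN.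
  by rewrite /w !mem_filter hs sN lN /= andbT; case: ifP => //; rewrite mul0r.
rewrite Re_sum; apply: eq_bigr => k _; case: (w k) => u v /=.
by rewrite mulNr.
Qed.

Lemma XN_bmeas (R : realType) N (f : R * R -> R) : XN N f -> bmeas f.
Proof. by move=> /XN_trig[p [q ->]]; exact: bmeas_trig. Qed.

Section FracLap.
Variable R : realType.
Variables (a c : R).
Let D := cell a (a + 2 * pi) c (c + 2 * pi).

Definition symbol (beta : R) (k : int * int) : R :=
  (k.1%:~R ^+ 2 + k.2%:~R ^+ 2) `^ beta.

Lemma symbolN beta k : symbol beta (- k) = symbol beta k.
Proof. by rewrite /symbol /= !intrN !sqrrN. Qed.

Lemma symbol_ge0 beta k : 0 <= symbol beta k.
Proof. exact: powR_ge0. Qed.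

Lemma symbol_half beta k : symbol (beta / 2) k ^+ 2 = symbol beta k.
Proof.
rewrite -powR_mulrn ?symbol_ge0// -powRrM; congr (_ `^ _).
by rewrite divfK.
Qed.

Lemma fracLap_partial_sum beta f M x : bmeas f ->
  complex.Re (\sum_(s <- zrange M) \sum_(l <- zrange M)
    ((((s%:~R ^+ 2 + l%:~R ^+ 2 : R) `^ beta))%:C)%C * fcoef D f s l * fmode s l x)
  = fourier_mult a c M (symbol beta) f x.
Proof.
move=> hf.
rewrite (big_box _ (fun k => (((k.1%:~R ^+ 2 + k.2%:~R ^+ 2 : R) `^ beta)%:C)%C
  * fcoef D f k.1 k.2 * fmode k.1 k.2 x)).
rewrite Re_sum /fourier_mult mulr_sumr; apply: eq_bigr => k _.
rewrite /fcoef /=.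
have -> : inner D f (fun x => cos ((- k.1)%:~R * x.1 + (- k.2)%:~R * x.2))
    = inner D f (hcos k).
  congr inner; apply/funext => y.
  by rewrite -[_ + _]/(phase (- k) y) phaseN cosN.
have -> : inner D f (fun x => sin ((- k.1)%:~R * x.1 + (- k.2)%:~R * x.2))
    = - inner D f (hsin k).
  rewrite ![inner _ f _]innerC -[- inner _ _ _]mulN1r -innerZl//;
    last exact: bmeas_hsin.
  congr inner; apply/funext => y.
  by rewrite -[_ + _]/(phase (- k) y) phaseN sinN mulN1r.
rewrite /hcos /hsin -!/(phase k x) /symbol.
by ring.
Qed.

Lemma fracLap_XN N beta f : XN N f ->
  fracLap D beta f = fourier_mult a c N (symbol beta) f.
Proof.
move=> /XN_trig[p [q ->]]; apply/funext => x; apply: cvg_lim => //.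
apply: cvg_near_cst; near=> M.
have NM : (N <= M)%N by near: M; exact: nbhs_infty_ge.
rewrite fracLap_partial_sum; last exact: bmeas_trig.
by rewrite !fourier_mult_trig//; exact: symbolN.
Unshelve. all: by end_near. Qed.

Lemma fourier_mult_symbol_half N beta f : XN N f ->
  fourier_mult a c N (symbol (beta / 2)) (fourier_mult a c N (symbol (beta / 2)) f) =
  fourier_mult a c N (symbol beta) f.
Proof.
move=> /XN_trig[p [q ->]].
have multE m : (forall k, m (- k) = m k) -> forall p' q' : int * int -> R,
    fourier_mult a c N m (trig N p' q') = trig N (m \* p') (m \* q').
  by move=> meven p' q'; exact: fourier_mult_trig.
have half_even := symbolN (beta / 2).
rewrite (multE _ half_even) (multE _ half_even) (multE _ (symbolN beta)).
by apply/funext => x; apply: eq_bigr => k _; rewrite /= !mulrA -!expr2 symbol_half.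
Qed.

(** The half power may be moved to the other factor, the multipliers being
    symmetric, and symbols multiply under composition. *)
Lemma normL2_fracLap N beta f : XN N f ->
  normL2 D (fracLap D (beta / 2) f) ^+ 2 =
  inner D (fourier_mult a c N (symbol beta) f) f.
Proof.
move=> fN; rewrite normL2_sqr (fracLap_XN _ fN) -(fourier_mult_symbol_half beta fN).
by apply: inner_fourier_multC; [exact: XN_bmeas fN | exact: bmeas_fourier_mult].
Qed.
End FracLap.

(** * Energy balance of one step *)

Section Dissipation.
Variable R : realType.
Variables (a c : R).
Let D := cell a (a + 2 * pi) c (c + 2 * pi).
Implicit Types f g h : R * R -> R.

Lemma innerLl (p q : R) f g h : bmeas f -> bmeas g -> bmeas h ->
  inner D (fun x => p * f x + q * g x) h = p * inner D f h + q * inner D g h.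
Proof.
move=> hf hg hh; have hpf := bmeasZ p hf; have hqg := bmeasZ q hg.
by rewrite innerDl// !innerZl.
Qed.

Lemma innerLr (p q : R) f g h : bmeas f -> bmeas g -> bmeas h ->
  inner D h (fun x => p * f x + q * g x) = p * inner D h f + q * inner D h g.
Proof. by move=> hf hg hh; rewrite innerC innerLl// ![inner D _ h]innerC. Qed.

Lemma XN_eq_of_inner N f g : XN N f -> XN N g ->
  (forall h, XN N h -> inner D f h = inner D g h) -> f = g.
Proof.
move=> fN gN fg.
have hN := XN_lin 1 (-1) fN gN; set h := fun x => _ in hN.
have hf := XN_bmeas fN; have hg := XN_bmeas gN; have hh := XN_bmeas hN.
have hE : h = fun=> 0.
  have : inner D h h = 0.
    by rewrite [in X in X = _]/h innerLl// -/h fg// mul1r mulN1r subrr.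
  by have [p [q ->]] := XN_trig hN; exact: trig_inner_eq0.
apply/funext => x; apply/eqP; rewrite -subr_eq0.
by have := congr1 (fun k => k x) hE; rewrite /h mul1r mulN1r => ->.
Qed.

(** The energy with both norms replaced by values of quadratic forms, which are
    bilinear in the increments. *)
Definition modal_energy N (kappa alpha : R) (u v : R * R -> R) (r : R) : R :=
  2^-1 * inner D v v
  + kappa / 2 * inner D (fourier_mult a c N (symbol (alpha / 2)) u) u + r ^+ 2.

Lemma energyH_modal N (kappa alpha : R) (u v : nat -> R * R -> R) (r : nat -> R) n :
  XN N (u n) ->
  energyH D kappa alpha u v r n = modal_energy N kappa alpha (u n) (v n) (r n).
Proof.
move=> uN; congr (2^-1 * _ + kappa / 2 * _ + _).
  exact: normL2_sqr.
have -> : alpha / 4 = alpha / 2 / 2 by field.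
exact: normL2_fracLap.
Qed.

Lemma C3_continuous_derive1 (F : R -> R) : C3 F -> continuous (derive1 F).
Proof.
move=> [dF _] x; apply/differentiable_continuous/derivable1_diffP.
exact: (dF 1%N).
Qed.

(** The nonlinear terms of the second and third relations carry the same inverse
    square root of [Efun], so its value cancels whatever it is, including the
    conventional inverse of 0; the function [w] only has to make them integrable. *)
Lemma sav_step_dissipative N (kappa alpha gamma1 gamma2 : R) (F : R -> R)
    (C0 tau : R) (u u' v v' w : R * R -> R) (r r' : R) :
  0 < tau -> 0 <= gamma1 -> 0 <= gamma2 -> C3 F -> bmeas w ->
  XN N u -> XN N u' -> XN N v -> XN N v' ->
  sav_relations D N kappa alpha gamma1 gamma2 F C0
    (tau^-1 *: (u' - u)) (tau^-1 *: (v' - v)) ((r' - r) / tau)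
    (2^-1 *: (u' + u)) (2^-1 *: (v' + v)) ((r' + r) / 2) w ->
  modal_energy N kappa alpha u' v' r' <= modal_energy N kappa alpha u v r.
Proof.
move=> tau0 g1 g2 F3 hw uN u'N vN v'N [].
have linB (k : R) f g : k *: (f - g) = fun x => k * f x + - k * g x.
  by apply/funext => x; rewrite mulNr -mulrBr.
have linD (k : R) f g : k *: (f + g) = fun x => k * f x + k * g x.
  by apply/funext => x; rewrite -mulrDr.
rewrite !linB !linD.
pose du x := tau^-1 * u' x + - tau^-1 * u x.
pose dv x := tau^-1 * v' x + - tau^-1 * v x.
pose ub x := 2^-1 * u' x + 2^-1 * u x.
pose vb x := 2^-1 * v' x + 2^-1 * v x.
rewrite -/du -/dv -/ub -/vb.
move=> eu ev er.
have ubN : XN N ub by exact: XN_lin.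
have vbN : XN N vb by exact: XN_lin.
have duN : XN N du by exact: XN_lin.
have duE : du = vb by exact: XN_eq_of_inner eu.
have {}ev := ev _ vbN.
have hu := XN_bmeas uN; have hu' := XN_bmeas u'N.
have hv := XN_bmeas vN; have hv' := XN_bmeas v'N.
have hub := XN_bmeas ubN; have hvb := XN_bmeas vbN; have hdu := XN_bmeas duN.
pose L := fourier_mult a c N (symbol (alpha / 2)).
have fracL z : XN N z -> fracLap D (alpha / 2) z = L z by exact: fracLap_XN.
move: ev.
rewrite (fracL _ ubN).
rewrite (fracL _ vbN).
have hL f : bmeas (L f) by exact: bmeas_fourier_mult.
have LC f g : bmeas f -> bmeas g -> inner D (L f) g = inner D (L g) f.
  exact: inner_fourier_multC.
have kin : inner D dv vb = (2 * tau)^-1 * (inner D v' v' - inner D v v).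
  rewrite innerLl// !innerLr// [inner D v v']innerC.
  by field; rewrite gt_eqF.
have pot : inner D (L ub) vb = (2 * tau)^-1 * (inner D (L u') u' - inner D (L u) u).
  rewrite -duE /L fourier_mult_lin// -/L innerLl// !innerLr// [inner D (L u') u]LC//.
  move: (inner D (L u) u') (inner D (L u) u) (inner D (L u') u') => p q s.
  by field; rewrite gt_eqF.
have dis : 0 <= inner D (L vb) vb.
  by apply: inner_fourier_mult_ge0 => // k; exact: symbol_ge0.
have dis0 := inner_ge0 a c vb.
have nonlin : (r' + r) / 2 *
    inner D (fun x => derive1 F (w x) / Num.sqrt (Efun D F C0 w)) vb
    = tau^-1 * (r' ^+ 2 - r ^+ 2).
  have hF : bmeas (fun x => derive1 F (w x)).
    exact: bmeas_comp (C3_continuous_derive1 F3) hw.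
  transitivity ((r' + r) * ((r' - r) / tau)); last by field; rewrite gt_eqF.
  rewrite er duE.
  have -> : (fun x => derive1 F (w x) / Num.sqrt (Efun D F C0 w)) =
            (fun x => (Num.sqrt (Efun D F C0 w))^-1 * derive1 F (w x)).
    by apply/funext => x; rewrite mulrC.
  rewrite innerZl// invfM.
  by move: (Num.sqrt _)^-1 (inner _ _ _) => s I; field.
rewrite kin pot nonlin /modal_energy -/L.
have := mulr_ge0 g1 dis; have := mulr_ge0 g2 dis0.
move: (gamma1 * _) (gamma2 * _) (inner _ v' v') (inner _ v v) (inner _ _ u')
  (inner _ _ u) => p q V' V U' U q0 p0 balance.
have loss : 0 <= tau * (p + q) by rewrite mulr_ge0 ?addr_ge0// ltW.
(* The energy lost over the step is exactly [tau * (p + q)]. *)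
rewrite -subr_ge0; apply: (le_trans loss); rewrite le_eqVlt; apply/orP; left.
rewrite -subr_eq0; apply/eqP.
rewrite -[RHS](mulr0 tau) -balance.
by field; rewrite gt_eqF.
Qed.
End Dissipation.

Unset Implicit Arguments.
Set Strict Implicit.

Theorem theorem3p2 (R : realType)
    (a b c d : R) (hab : b = a + 2 * pi) (hcd : d = c + 2 * pi)
    (kappa alpha gamma1 gamma2 : R)
    (hkappa : 0 < kappa) (halpha : 1 < alpha <= 2)
    (hgamma1 : 0 <= gamma1) (hgamma2 : 0 <= gamma2)
    (F : R -> R) (C0 : R)
    (hF0 : forall y : R, 0 <= F y) (hF3 : C3 F)
    (hFlip : locally_lipschitz (derive1 F))
    (hE : Efun_pos (cell a b c d) F C0)
    (T : R) (hT : 0 < T) (N K : nat) (hN : (0 < N)%N) (hK : (0 < K)%N)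
    (tau : R) (htau : tau = T / K%:R)
    (u0 v0 : R * R -> R)
    (hu0per : periodic2pi u0) (hv0per : periodic2pi v0)
    (hu0 : square_integrable (cell a b c d) u0)
    (hv0 : square_integrable (cell a b c d) v0)
    (hFu0 : (@lebesgue2 R).-integrable (cell a b c d) (fun x => (F (u0 x))%:E))
    (u v : nat -> R * R -> R) (r : nat -> R)
    (ut vt : R * R -> R) (rt : R)
    (hsol : sav_solution (cell a b c d) N K kappa alpha gamma1 gamma2 F C0 tau
              u0 v0 u v r ut vt rt) :
  forall n : nat, (1 <= n <= K.+1)%N ->
    energyH (cell a b c d) kappa alpha u v r n
      <= energyH (cell a b c d) kappa alpha u v r n.-1.
Proof.
move=> [//|n] /= nK.
subst b d.
have tau0 : 0 < tau by rewrite htau divr_gt0 ?ltr0n.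
have XNu m : (m <= K.+1)%N -> XN N (u m).
  by case: m => [_|m mK]; [have [] := sav_u0 hsol | exact: sav_XN_u hsol m mK].
have XNv m : (m <= K.+1)%N -> XN N (v m).
  by case: m => [_|m mK]; [have [] := sav_v0 hsol | exact: sav_XN_v hsol m mK].
have XNw : bmeas (utilde ut u n).
  case: n nK => [_|n nK]; first exact: XN_bmeas (sav_XN_ut hsol).
  have un1 := XN_bmeas (XNu n.+1 (ltnW nK)).
  have un := XN_bmeas (XNu n (ltnW (ltnW nK))).
  rewrite (_ : utilde _ _ _ = fun x => 2^-1 * (3 * u n.+1 x + (-1) * u n x)).
    by apply/bmeasZ/bmeasD; exact: bmeasZ.
  by apply/funext => x; rewrite mulN1r.
have nK' : (n <= K)%N by [].
have step := sav_step hsol nK'.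
rewrite (energyH_modal _ _ _ _ _ _ (XNu n.+1 nK)).
rewrite (energyH_modal _ _ _ _ _ _ (XNu n (leqW nK'))).
apply: (sav_step_dissipative tau0 hgamma1 hgamma2 hF3 XNw) step.
- exact: XNu (leqW nK').
- exact: XNu nK.
- exact: XNv (leqW nK').
- exact: XNv nK.
Qed.
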